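(* Let $\mathcal{O}_1,\dots,\mathcal{O}_{n_o}\subseteq\mathbb{R}^3$ be (overapproximations of) obstacles and let $\mathcal{F}=\mathbb{R}^3\setminus(\mathcal{O}_1\cup\dots\cup\mathcal{O}_{n_o})$ be the safe flight space. Suppose that there exist $n_s$ convex sets $\mathcal{S}_1,\dots,\mathcal{S}_{n_s}$ with $\mathcal{S}_l\subset\mathcal{F}$ for $l=1,\dots,n_s$ and $\mathcal{S}_i\cap\mathcal{S}_{i+1}\ne\emptyset$ for $i=1,\dots,n_s-1$. Let $\boldsymbol{r}(t)$ be a clamped uniform B-spline curve of degree $d$ with $N+1$ control points $\boldsymbol{P}_0,\dots,\boldsymbol{P}_N\in\mathbb{R}^3$, where $N=n_s+d-1$. If $$\boldsymbol{P}_{j-1}\in\mathcal{S}_l,\qquad j=l,\dots,l+d,\quad l=1,\dots,n_s,$$ then $\boldsymbol{r}(t)\in\mathcal{F}$ for all $t\in[\tau_0,\tau_v)$, and $\boldsymbol{r}(t)$ is at least $C^{d-1}$ on $[\tau_0,\tau_v)$.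
   Context: Integers $d\ge1$, $N\ge d$, $v=N+d+1$; knot vector $\tau_0\le\dots\le\tau_v$ with $\tau_0<\tau_v$ that is clamped ($\tau_0=\dots=\tau_d$, $\tau_{v-d}=\dots=\tau_v$) and uniform ($\tau_{d+1}-\tau_d=\dots=\tau_{N+1}-\tau_N$). Basis functions: $\lambda_{i,0}(t)=1$ if $\tau_i\le t<\tau_{i+1}$ and $0$ otherwise; $\lambda_{i,k}(t)=\frac{t-\tau_i}{\tau_{i+k}-\tau_i}\lambda_{i,k-1}(t)+\frac{\tau_{i+k+1}-t}{\tau_{i+k+1}-\tau_{i+1}}\lambda_{i+1,k-1}(t)$, where a term with zero denominator is taken to be $0$. The B-spline curve of degree $d$ with control points $\boldsymbol{P}_0,\dots,\boldsymbol{P}_N$ is $\boldsymbol{r}(t)=\sum_{i=0}^N\boldsymbol{P}_i\lambda_{i,d}(t)$, $t\in[\tau_0,\tau_v)$. *)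

(* Defs.v *)
From HB Require Import structures.
From mathcomp Require Import all_boot all_order all_algebra.
From mathcomp Require Import all_classical all_reals.
From mathcomp Require Import topology normedtype convex.

Set Implicit Arguments.
Unset Strict Implicit.
Unset Printing Implicit Defensive.

Import Order.TTheory GRing.Theory Num.Theory.
Import numFieldNormedType.Exports.

Local Open Scope classical_set_scope.
Local Open Scope ring_scope.

(* A knot vector tau_0, ..., tau_v with v = N + d + 1 is a function on nat of
   which only the values at indices <= v are constrained, or used by the basis
   functions of degree <= d with index <= N. *)

Definition knot_vector (R : realType) (v : nat) (tau : nat -> R) : Prop :=
  (forall i : nat, (i < v)%N -> tau i <= tau i.+1) /\ tau 0%N < tau v.

Definition clamped (R : realType) (d v : nat) (tau : nat -> R) : Prop :=
  (forall i : nat, (i <= d)%N -> tau i = tau 0%N) /\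
  (forall i : nat, (v - d <= i <= v)%N -> tau i = tau v).

(* tau_{d+1} - tau_d = ... = tau_{N+1} - tau_N: only the inner spacings. *)
Definition uniform (R : realType) (d N : nat) (tau : nat -> R) : Prop :=
  forall i : nat, (d <= i <= N)%N ->
    tau i.+1 - tau i = tau d.+1 - tau d.

(* Cox-de Boor recursion.  The convention that a term with zero denominator is
   0 is provided by x / 0 = 0 in a fieldType. *)
Fixpoint bspline_basis (R : realType) (tau : nat -> R) (i k : nat) (t : R) : R :=
  match k with
  | 0%N => if tau i <= t < tau i.+1 then 1 else 0
  | k'.+1 =>
      (t - tau i) / (tau (i + k)%N - tau i) * bspline_basis tau i k' t
      + (tau (i + k).+1 - t) / (tau (i + k).+1 - tau i.+1)
        * bspline_basis tau i.+1 k' t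
  end.

(* Only meaningful for t in [tau_0, tau_v); this function is 0 elsewhere. *)
Definition bspline_curve (R : realType) (m d N : nat) (tau : nat -> R)
    (P : 'I_N.+1 -> 'rV[R]_m) (t : R) : 'rV[R]_m :=
  \sum_(i < N.+1) bspline_basis tau i d t *: P i.

Definition safe_space (R : realType) (m no : nat)
    (O : 'I_no -> set 'rV[R]_m) : set 'rV[R]_m :=
  [set: 'rV[R]_m] `\` \bigcup_(i in [set: 'I_no]) O i.

(* Difference quotients are taken within D, so the derivative is one-sided at
   an endpoint of an interval D belonging to D, and the values of f outside D
   are irrelevant. *)
Definition is_derive_within (R : realType) (V : normedModType R) (D : set R)
    (f f' : R -> V) : Prop :=
  forall t : R, D t ->
    (fun s : R => (s - t)^-1 *: (f s - f t)) @ within D t^' --> f' t.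

(* f is of class C^k on D, for D an interval with nonempty interior. *)
Fixpoint class_C (R : realType) (V : normedModType R) (k : nat) (D : set R)
    (f : R -> V) : Prop :=
  match k with
  | 0%N => {within D, continuous f}
  | k'.+1 => exists f' : R -> V, is_derive_within D f f' /\ class_C k' D f'
  end.

(* Main.v *)
(* On a knot interval [tau_j, tau_(j+1)), the degree-d curve depends only on
   P_(j-d), ..., P_j, all of which lie in a single convex set S_l; running
   de Boor's algorithm, it is obtained from them by iterated convex
   combinations, hence stays in S_l.

   For smoothness, the classical identity
     B_(i,k+1)' = (k+1) (B_(i,k) / (tau_(i+k+1) - tau_i)
                         - B_(i+1,k) / (tau_(i+k+2) - tau_(i+1)))
   holds for the polynomial pieces on each knot interval.  Neighbouring pieces
   of degree >= 1 agree at a simple knot, and clamped uniform knots are simple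
   strictly inside (tau_0, tau_v); so the one-sided derivatives agree there as
   soon as the degree is at least 2, and one inducts on the degree. *)
Require Import Defs.
From HB Require Import structures.
From mathcomp Require Import all_boot all_order all_algebra.
From mathcomp Require Import all_classical all_reals.
From mathcomp Require Import topology normedtype convex.
From mathcomp Require Import derive ring zify interval_inference.

Set Implicit Arguments.
Unset Strict Implicit.
Unset Printing Implicit Defensive.

Import Order.TTheory GRing.Theory Num.Theory.
Import numFieldNormedType.Exports.

Local Open Scope classical_set_scope.
Local Open Scope ring_scope.

(** * Closure properties of the classes C^k *)

Lemma class_CD (R : realType) (V : normedModType R) k (D : set R)
    (f g : R -> V) :
  class_C k D f -> class_C k D g -> class_C k D (fun t => f t + g t).
Proof.
elim: k f g => [|k IH] f g /= => [cf cg x|[f' [ff' cf']] [g' [gg' cg']]].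
  exact: (cvgD (cf x) (cg x)).
exists (fun t => f' t + g' t); split; last exact: IH.
move=> t Dt; have -> : (fun s => (s - t)^-1 *: (f s + g s - (f t + g t))) =
    (fun s => (s - t)^-1 *: (f s - f t) + (s - t)^-1 *: (g s - g t)).
  by apply/funext => s; rewrite -scalerDr opprD addrACA.
exact: cvgD (ff' t Dt) (gg' t Dt).
Qed.

Lemma class_C0 (R : realType) (V : normedModType R) k (D : set R) :
  class_C k D (fun=> 0 : V).
Proof.
elim: k => [|k IH] /=; first by move=> x; exact: cvg_cst.
exists (fun=> 0); split => // t Dt.
under eq_fun do rewrite subrr scaler0.
exact: cvg_cst.
Qed.

Lemma class_C_sum (R : realType) (V : normedModType R) k (D : set R)
    (I : Type) (r : seq I) (f : I -> R -> V) :
  (forall i, class_C k D (f i)) ->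
  class_C k D (fun t => \sum_(i <- r) f i t).
Proof.
move=> cf; elim: r => [|i r IH].
  by under eq_fun do rewrite big_nil; exact: class_C0.
by under eq_fun do rewrite big_cons; exact: class_CD.
Qed.

(** Writing p - p(t) = (X - t) q turns the difference quotient into q(s), and q is continuous with
    q(t) = p'(t). The epsilon form allows the estimates for two neighbouring pieces to be
    combined. *)
Lemma cvg_horner_quotient (R : realType) (p : {poly R}) (t e : R) : 0 < e ->
  \forall s \near t^', `|p^`().[t] - (s - t)^-1 * (p.[s] - p.[t])| < e.
Proof.
move=> e0.
have /factor_theorem[q pE] : root (p - p.[t]%:P) t.
  by rewrite rootE !hornerE subrr.
have -> : p^`().[t] = q.[t].
  have : (p - p.[t]%:P)^`() = p^`() by rewrite !poly.derivE subr0.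
  by rewrite pE derivM => <-; rewrite !poly.derivE !hornerE; ring.
have qE s : p.[s] - p.[t] = (s - t) * q.[s].
  by have /(congr1 (fun r => r.[s])) := pE; rewrite !hornerE => ->; rewrite mulrC.
have /cvgrPdist_lt/(_ e e0)[d/= d0 qd] := @continuous_horner R q t.
exists d => //= s sd st; rewrite qE mulKf ?subr_eq0//; exact: qd.
Qed.

(** * Polynomial pieces of the basis functions *)

Section spline.
Context {R : realType} (tau : nat -> R).
Hypothesis tau_nd : {homo tau : i j / (i <= j)%N >-> i <= j}.

Definition in_piece (j : nat) (t : R) := tau j <= t < tau j.+1.

(** The Cox-de Boor recursion started from the Kronecker delta: the polynomial that the basis
    function restricts to on the knot interval j. *)
Fixpoint bspline_poly (j i k : nat) : {poly R} :=
  match k with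
  | 0%N => (i == j)%:R
  | k'.+1 =>
      ((tau (i + k').+1 - tau i)^-1)%:P * ('X - (tau i)%:P)
        * bspline_poly j i k'
      + ((tau (i + k').+2 - tau i.+1)^-1)%:P * ((tau (i + k').+2)%:P - 'X)
        * bspline_poly j i.+1 k'
  end.

Lemma horner_bspline_polyS j i k t : (bspline_poly j i k.+1).[t] =
  (t - tau i) / (tau (i + k).+1 - tau i) * (bspline_poly j i k).[t]
  + (tau (i + k).+2 - t) / (tau (i + k).+2 - tau i.+1)
    * (bspline_poly j i.+1 k).[t].
Proof. by rewrite /= !hornerE; ring. Qed.

Lemma in_piece_inj i j t : in_piece i t -> in_piece j t -> i = j.
Proof.
wlog ij : i j / (i <= j)%N => [H it jt|/andP[_ ti] /andP[jt _]].
  by have [ij|/ltnW ji] := leqP i j; [exact: H|rewrite (H j i)].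
apply/eqP; rewrite eqn_leq ij/= leqNgt; apply/negP => /tau_nd ji.
by move: (le_lt_trans (le_trans ji jt) ti); rewrite ltxx.
Qed.

Lemma bspline_polyE j i k t : in_piece j t ->
  bspline_basis tau i k t = (bspline_poly j i k).[t].
Proof.
move=> jt; elim: k i => [|k IH] i.
  rewrite /=; case: eqVneq => [->|ij]; first by rewrite (_ : _ <= _ < _)// hornerC.
  rewrite ifF ?hornerE//; apply: contra_neqF ij => it.
  exact: in_piece_inj it jt.
by rewrite horner_bspline_polyS /= !IH !addnS.
Qed.

Lemma bspline_poly_deriv j i k :
  (bspline_poly j i k.+1)^`() = k.+1%:R *
    (((tau (i + k).+1 - tau i)^-1)%:P * bspline_poly j i k
     - ((tau (i + k).+2 - tau i.+1)^-1)%:P * bspline_poly j i.+1 k).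
Proof.
elim: k i => [|k IH] i.
  by rewrite /= !poly.derivE; case: eqP; case: eqP => _ _ /=; rewrite ?poly.derivE; ring.
rewrite [bspline_poly j i k.+2]/= derivD !derivM !IH !poly.derivE.
(* If the larger knot span vanishes then so does the smaller one, and both
   sides are 0 because 0^-1 = 0. *)
have wE m n m' n' : (m <= m')%N -> (m' <= n')%N -> (n' <= n)%N ->
    (tau n - tau m)^-1 * (tau n - tau m) * (tau n' - tau m')^-1
    = (tau n' - tau m')^-1.
  move=> mm mn nn; have [e|ne] := eqVneq (tau n - tau m) 0; last first.
    by rewrite mulVf// mul1r.
  have -> : tau n' - tau m' = 0; last by rewrite invr0 mulr0.
  apply/eqP; rewrite eq_le subr_ge0 tau_nd// andbT -e lerB ?tau_nd//.
have E0 := wE i (i + k).+2 i.+1 (i + k).+2.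
have E1 := wE i.+1 (i + k).+3 i.+1 (i + k).+2.
rewrite /= !addnS !addSn in E0 E1 *.
set a := ((tau (i + k).+1 - tau i)^-1)%:P.
set b := ((tau (i + k).+2 - tau i.+1)^-1)%:P.
set c := ((tau (i + k).+3 - tau i.+2)^-1)%:P.
set W0 := ((tau (i + k).+2 - tau i)^-1)%:P.
set W1 := ((tau (i + k).+3 - tau i.+1)^-1)%:P.
have {}E0 : W0 * ((tau (i + k).+2)%:P - (tau i)%:P) * b = b.
  by rewrite -polyCB -!polyCM E0//; lia.
have {}E1 : W1 * ((tau (i + k).+3)%:P - (tau i.+1)%:P) * b = b.
  by rewrite -polyCB -!polyCM E1//; lia.
move: (bspline_poly j i k) (bspline_poly j i.+1 k) (bspline_poly j i.+2 k)
  => A B C.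
move: a b c W0 W1 (tau i)%:P (tau i.+1)%:P (tau (i + k).+2)%:P
  (tau (i + k).+3)%:P E0 E1 => a b c W0 W1 t0 t1 t2 t3 E0 E1.
(* In the difference of the two sides the [A] and [C] terms cancel identically; the rest is a
   multiple of [B] which [E0] and [E1] reduce to b - b. *)
apply/eqP; rewrite -subr_eq0; apply/eqP.
transitivity (k.+1%:R * (B * (W1 * (t3 - t1) * b - W0 * (t2 - t0) * b))).
  by ring.
by rewrite E0 E1 subrr !mulr0.
Qed.

Lemma horner_bspline_poly_deriv j i k t :
  (bspline_poly j i k.+1)^`().[t] =
  k.+1%:R / (tau (i + k).+1 - tau i) * (bspline_poly j i k).[t]
  - k.+1%:R / (tau (i + k).+2 - tau i.+1) * (bspline_poly j i.+1 k).[t].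
Proof.
rewrite bspline_poly_deriv -[k.+1%:R in LHS]polyC_natr !hornerE.
by ring.
Qed.

(** At a fixed point the coefficients of the recursion do not depend on the piece, so degree 1
    suffices. There both hat function pieces take the value 1 if i = j and 0 otherwise. *)
Lemma bspline_poly_knot j i k : tau j < tau j.+1 -> tau j.+1 < tau j.+2 ->
  (bspline_poly j i k.+1).[tau j.+1] = (bspline_poly j.+1 i k.+1).[tau j.+1].
Proof.
move=> j1 j2; elim: k i => [|k IH] i; last first.
  by rewrite !(horner_bspline_polyS _ _ k.+1) !IH.
have n1 : tau j.+1 - tau j != 0 by rewrite subr_eq0 gt_eqF.
have e1 : (j == j.+1) = false by lia.
have e2 : (j.+1 == j) = false by lia.
have n2 : tau j.+2 - tau j.+1 != 0 by rewrite subr_eq0 gt_eqF.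
rewrite !horner_bspline_polyS /= addn0.
have [->|ij] := eqVneq i j.
  by rewrite !eqxx e1 e2 !hornerE mulfV// mulfV//; ring.
have [->|ij1] := eqVneq i j.+1.
  by rewrite [j.+2 == j.+1]eqSS e2 [j.+2 == j]gtn_eqF// !hornerE; ring.
rewrite [i.+1 == j.+1]eqSS (negPf ij) !hornerE.
case: eqP => [->|_]; rewrite !hornerE; last by ring.
by rewrite !subrr; ring.
Qed.

Lemma in_piece_ex n t : tau 0%N <= t < tau n ->
  exists2 j, (j < n)%N & in_piece j t.
Proof.
elim: n => [|n IH] /andP[t0 tn]; first by move: (le_lt_trans t0 tn); rewrite ltxx.
have [nt|tn'] := leP (tau n) t; first by exists n => //; exact/andP.
by have [|j jn jt] := IH; [rewrite t0|exists j => //; exact: ltnW].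
Qed.

(** * Smoothness across simple knots *)

Section smoothness.
Variable n : nat.
Hypothesis tau_simple : forall j, tau 0%N < tau j.+1 < tau n ->
  tau j < tau j.+1 < tau j.+2.

(* j' is the interval to the left of t when t is an interior knot, and j
   otherwise. *)
Lemma near_in_piece t : tau 0%N <= t < tau n -> exists j j', [/\ in_piece j t,
  \forall s \near t, tau 0%N <= s -> in_piece j s \/ in_piece j' s &
  forall i k, (bspline_poly j' i k.+1).[t] = (bspline_poly j i k.+1).[t]].
Proof.
move=> t0n; have [j jn /[dup] jt /andP[tj tj1]] := in_piece_ex t0n.
move: tj; rewrite le_eqVlt => /predU1P[tE|tj]; last first.
  exists j, j; split => //; near=> s => _; left; apply/andP; split.
    by apply: ltW; near: s; exact: lt_nbhsr.
  by near: s; exact: lt_nbhsl.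
(* At the left endpoint the condition on s excludes the points left of t, so one piece is enough. *)
have [t0|t0] := eqVneq t (tau 0%N).
  exists j, j; split => //; near=> s => s0; left; apply/andP; split.
    by rewrite tE t0.
  by near: s; exact: lt_nbhsl.
case: j => [|j] in jn jt tE tj1 *; first by rewrite tE eqxx in t0.
have /andP[lj lj1] : tau j < tau j.+1 < tau j.+2.
  apply: tau_simple; rewrite tE.
  by move: t0n => /andP[t0t ->]; rewrite lt_neqAle eq_sym t0 t0t.
exists j.+1, j; split => //; last by move=> i k; rewrite -tE bspline_poly_knot.
near=> s => _; have [ts|st] := leP t s.
  left; apply/andP; rewrite tE; split => //.
  by near: s; exact: lt_nbhsl.
right; apply/andP; rewrite tE; split => //.
by apply: ltW; near: s; apply: lt_nbhsr; rewrite -tE.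
Unshelve. all: by end_near. Qed.

(** Induction on k, for all x at once: the constants of the derivative formula are absorbed into x,
    so the derivative is a sum of two functions covered by the induction hypothesis. *)
Lemma class_C_bspline_basis (V : normedModType R) k i (x : V) :
  class_C k `[tau 0%N, tau n[ (fun t => bspline_basis tau i k.+1 t *: x).
Proof.
have DE s : `[tau 0%N, tau n[%classic s -> tau 0%N <= s < tau n.
  by rewrite /= in_itv.
elim: k i x => [|k IH] i x.
  apply/subspace_continuousP => t /DE t0n.
  have [j [j' [jt js jj']]] := near_in_piece t0n.
  apply: cvgZr_tmp; apply/cvgrPdist_lt => e e0.
  have cp m : \forall s \near t,
      `|(bspline_poly m i 1).[t] - (bspline_poly m i 1).[s]| < e.
    by have /cvgrPdist_lt/(_ e e0) := @continuous_horner R (bspline_poly m i 1) t.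
  apply: filterS3 (cp j) (cp j') js => s pj pj' js /DE/andP[/js + _].
  rewrite (bspline_polyE _ _ jt); case=> sj; rewrite (bspline_polyE _ _ sj)//.
  by rewrite -jj'.
set a := k.+2%:R / (tau (i + k.+1).+1 - tau i).
set b := k.+2%:R / (tau (i + k.+1).+2 - tau i.+1).
exists (fun t => bspline_basis tau i k.+1 t *: (a *: x)
               + bspline_basis tau i.+1 k.+1 t *: (- b *: x)); split; last first.
  by apply: class_CD; exact: IH.
move=> t /DE t0n.
have [j [j' [jt js jj']]] := near_in_piece t0n.
rewrite !scalerA -scalerDl.
under eq_fun do rewrite -scalerBl scalerA.
apply: cvgZr_tmp.
(* Pieces of degree k+1 on both sides of t agree at t, so the pieces of degree k+2 have the same
   derivative there. *)
have dE m : (forall i k, (bspline_poly m i k.+1).[t] = (bspline_poly j i k.+1).[t]) ->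
    bspline_basis tau i k.+1 t * a + bspline_basis tau i.+1 k.+1 t * - b
      = (bspline_poly m i k.+2)^`().[t].
  move=> mj; rewrite horner_bspline_poly_deriv !(bspline_polyE _ _ jt) !mj.
  by rewrite -/a -/b; ring.
apply/cvgrPdist_lt => e e0.
apply: filterS3 (cvg_horner_quotient (bspline_poly j i k.+2) t e0)
  (cvg_horner_quotient (bspline_poly j' i k.+2) t e0) (nbhs_dnbhs js).
move=> s pj pj' js' /DE/andP[/js' + _].
rewrite (bspline_polyE _ k.+2 jt); case=> sj; rewrite (bspline_polyE _ _ sj).
  by rewrite (dE j).
by rewrite (dE j')// -jj'.
Qed.
End smoothness.

(** * Local support and the convex hull property *)

Lemma bspline_basis_support i k t : t < tau i \/ tau (i + k).+1 <= t ->
  bspline_basis tau i k t = 0.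
Proof.
elim: k i => [|k IH] i /= tik.
  case: ifP => // /andP[it ti]; case: tik => [|].
    by rewrite ltNge it.
  by rewrite addn0 leNgt ti.
rewrite !IH ?mulr0 ?addr0//.
  case: tik => [ti|]; last by rewrite addSnnS; right.
  by left; apply: (lt_le_trans ti); exact: tau_nd.
case: tik => [|ti]; first by left.
by right; apply: le_trans ti; apply: tau_nd; rewrite addnS.
Qed.

(* One step of de Boor's algorithm lowers the degree and replaces the control
   points by convex combinations of neighbours. *)
Lemma bspline_in_convex (V : lmodType R) (A : set V) j k n t (Q : nat -> V) :
  convex_set A -> in_piece j t -> (k <= j < n)%N ->
  (forall i, (j - k <= i <= j)%N -> A (Q i)) ->
  A (\sum_(i < n) bspline_basis tau i k t *: Q i).
Proof.
move=> cA /[dup] jt /andP[tj tj1]; elim: k Q => [|k IH] Q /andP[kj jn] AQ.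
  rewrite (bigD1 (Ordinal jn))//= (_ : _ <= _ < _)// scale1r big1 ?addr0.
    by apply: AQ; lia.
  move=> i ij; rewrite ifF ?scale0r//; apply: contra_neqF ij => it.
  exact/val_inj/(in_piece_inj it jt).
pose w i := (tau (i + k).+1 - tau i)^-1.
(* The junk value [Q 0.-1] in [Q' 0] is harmless: its basis function vanishes at t, because k+1 <=
   j. *)
pose Q' i := ((t - tau i) * w i) *: Q i
  + ((tau (i + k).+1 - t) * w i) *: Q i.-1.
suff -> : \sum_(i < n) bspline_basis tau i k.+1 t *: Q i =
    \sum_(i < n) bspline_basis tau i k t *: Q' i.
  apply: IH => [|i ikj]; first by rewrite jn ltnW.
  have ti : tau i <= t by apply: le_trans tj; apply: tau_nd; lia.
  have tik : t < tau (i + k).+1.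
    by apply: (lt_le_trans tj1); apply: tau_nd; lia.
  have w0 : 0 < tau (i + k).+1 - tau i by rewrite subr_gt0 (le_lt_trans ti).
  have l01 : 0 <= (t - tau i) * w i <= 1.
    apply/andP; split; first by rewrite divr_ge0 ?subr_ge0// ltW// -subr_gt0.
    by rewrite /w ler_pdivrMr// mul1r lerD2r ltW.
  have := cA (Q i) (Q i.-1) (Itv01 (andP l01).1 (andP l01).2).
  rewrite !inE /Q' => cQ.
  have -> : (tau (i + k).+1 - t) * w i = 1 - (t - tau i) * w i.
    rewrite /w; field; exact: lt0r_neq0.
  apply: cQ; apply: AQ; lia.
have ss m : bspline_basis tau m k t *: Q' m =
   ((t - tau m) * w m * bspline_basis tau m k t) *: Q m
   + ((tau (m + k).+1 - t) * w m * bspline_basis tau m k t) *: Q m.-1.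
  by rewrite /Q' scalerDr !scalerA ![_ * bspline_basis _ _ _ _]mulrC.
under [RHS]eq_bigr do rewrite ss.
under [LHS]eq_bigr do rewrite /= addnS scalerDl.
rewrite !big_split/=; congr (_ + _).
(* The two sums differ by an index shift; the unmatched last term on the left and first term on the
   right vanish since t lies outside their supports. *)
case: n jn {IH} => // n jn; rewrite big_ord_recr big_ord_recl /=.
rewrite [X in _ + X *: _ = _](_ : _ = 0); last first.
  rewrite bspline_basis_support ?mulr0//; left.
  by apply: (lt_le_trans tj1); exact: tau_nd.
rewrite [X in X *: _ + _](_ : _ = 0); last first.
  rewrite bspline_basis_support ?mulr0//; right.
  by apply: le_trans tj; apply: tau_nd; rewrite add0n.
by rewrite !scale0r addr0 add0r.
Qed.
End spline.

(** * Clamped uniform knots and the safe corridor *)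

Lemma bspline_basis_ext (R : realType) (tau tau' : nat -> R) i k t :
  (forall m, (i <= m <= (i + k).+1)%N -> tau m = tau' m) ->
  bspline_basis tau i k t = bspline_basis tau' i k t.
Proof.
elim: k i => [|k IH] i e /=; first by rewrite !e//; lia.
by rewrite !IH ?e//; try lia; move=> m im; apply: e; lia.
Qed.

Theorem proposition2 (R : realType) (no ns d N : nat)
  (O : 'I_no -> set 'rV[R]_3) (S : 'I_ns -> set 'rV[R]_3)
  (tau : nat -> R) (P : 'I_N.+1 -> 'rV[R]_3)
  (d_ge1 : (1 <= d)%N) (N_ge_d : (d <= N)%N)
  (NE : N = (ns + d - 1)%N)
  (S_convex : forall l : 'I_ns, convex_set (S l))
  (S_safe : forall l : 'I_ns, S l `<=` safe_space O)
  (S_meet : forall i j : 'I_ns, nat_of_ord j = i.+1 -> S i `&` S j !=set0)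
  (tau_knots : knot_vector (N + d + 1) tau)
  (tau_clamped : clamped d (N + d + 1) tau)
  (tau_uniform : uniform d N tau)
  (P_in_S : forall (l : 'I_ns) (j : 'I_N.+1), (l <= j <= l + d)%N -> S l (P j)) :
  (forall t : R, tau 0%N <= t < tau (N + d + 1)%N ->
     safe_space O (bspline_curve d tau P t)) /\
  class_C (d - 1) `[tau 0%N, tau (N + d + 1)%N[ (bspline_curve d tau P).
Proof.
(* Freezing the knots after tau_v makes the knot sequence monotone on all of
   nat without affecting the curve. *)
pose v := (N + d + 1)%N.
pose sigma i := tau (minn i v).
have sE i : (i <= v)%N -> sigma i = tau i.
  by move=> /minn_idPl; rewrite /sigma => ->.
case: tau_knots => tau_le tau_lt; case: tau_clamped => tau_l tau_r.
have s_nd : {homo sigma : i j / (i <= j)%N >-> i <= j}.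
  apply: homo_leq => [|y x z|i]; [exact: lexx|exact: le_trans|].
  have [iv|vi] := ltnP i v; first by rewrite !sE ?tau_le// ltnW.
  by rewrite /sigma !(minn_idPr _) ?lexx//; lia.
have s0 : sigma 0%N = tau 0%N by exact: sE.
have sv : sigma v = tau v by exact: sE.
have curveE : bspline_curve d tau P =
    fun t => \sum_(i < N.+1) bspline_basis sigma i d t *: P i.
  apply/funext => t; apply: eq_bigr => i _; congr (_ *: _).
  by apply: bspline_basis_ext => m im; rewrite sE// /v; have := ltn_ord i; lia.
have sl i : (i <= d)%N -> sigma i = tau 0%N.
  by move=> id; rewrite sE ?tau_l// /v; lia.
have sr i : (N < i)%N -> sigma i = tau v.
  move=> Ni; have [iv|vi] := leqP i v; last by rewrite /sigma (minn_idPr _)// ltnW.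
  by rewrite sE// tau_r// iv andbT /v; lia.
have piece_bounds j t : in_piece sigma j t -> (d <= j <= N)%N.
  move=> /andP[tj tj1]; have lt_j := le_lt_trans tj tj1.
  apply/andP; split; rewrite leqNgt; apply/negP => jd; move: lt_j.
    by rewrite !sl ?ltxx// ltnW.
  by rewrite !sr ?ltxx// leqW.
(* The interval containing tau_0 has positive length and, by [piece_bounds], an index in [d, N];
   uniformity gives all intervals in that range the same length. *)
have step j : (d <= j <= N)%N -> sigma j < sigma j.+1.
  have [|j0 _ j0t] := @in_piece_ex R sigma v (tau 0%N).
    by rewrite s0 sv lexx.
  have spacing i : (d <= i <= N)%N -> sigma i.+1 - sigma i = tau d.+1 - tau d.
    by move=> di; rewrite !sE ?tau_uniform// /v; lia.
  move=> /spacing jE; rewrite -subr_gt0 jE -(spacing _ (piece_bounds _ _ j0t)).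
  by rewrite subr_gt0; move: j0t => /andP[]; exact: le_lt_trans.
split=> [t t0v|]; rewrite curveE; last first.
  rewrite -s0 -sv -{2}(subnK d_ge1) addn1; apply: class_C_sum => i.
  apply: class_C_bspline_basis => // j /andP[j0 jv].
  (* A knot strictly inside the domain has index j+1 with d <= j < N, so [step] applies on both
     sides of it. *)
  have dj : (d <= j)%N.
    by rewrite leqNgt; apply: contraTN j0 => jd; rewrite !sl ?ltxx.
  have jN : (j < N)%N.
    by rewrite ltnNge; apply: contraTN jv => Nj; rewrite sv sr ?ltxx.
  by rewrite !step//; lia.
rewrite -s0 -sv in t0v; have [j _ jt] := in_piece_ex t0v.
have /andP[dj jN] := piece_bounds _ _ jt.
(* With sets numbered from 0, the active points P_(j-d), ..., P_j are those assigned to the set l =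
   j - d. *)
have lt_l : (j - d < ns)%N by lia.
apply: (@S_safe (Ordinal lt_l)).
(* [inord] extends the control points to all of nat, as [bspline_in_convex] expects. *)
have -> : \sum_(i < N.+1) bspline_basis sigma i d t *: P i =
    \sum_(i < N.+1) bspline_basis sigma i d t *: P (inord i).
  by apply: eq_bigr => i _; rewrite inord_val.
apply: (bspline_in_convex (Q := fun i => P (inord i)) s_nd _ jt) => //.
  by rewrite dj ltnS.
move=> i ij; apply: P_in_S => /=; rewrite inordK; lia.
Qed.
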